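(* Let $N\ge 2$, $p\in(0,1]$, and let $\mathcal{H}_A$ have orthonormal basis $\ket{1},\ldots,\ket{N}$. For $i\in\{1,\ldots,N\}$ let $O_i$ be a unitary on $\mathcal{H}_A\otimes\mathbb{C}^2$ with $O_i\ket{i}\ket{0}=-\ket{i}\ket{1}$ and $O_i\ket{j}\ket{0}=\ket{j}\ket{1}$ for $j\neq i$, and let $\mathcal{F}_i(\rho)=p\,O_i\rho O_i^\dagger+(1-p)\rho$. Given oracle access to $\mathcal{F}_i$ for an unknown $i$, the index $i$ can be identified with probability at least $1/4$ using $\lfloor\pi/(2\theta p)\rfloor$ queries to the oracle, where $\theta=2\arcsin(1/\sqrt{N})$.
   Context: The algorithm may use a workspace, arbitrary unitaries, and calls of $\mathcal{F}_i\otimes\mathrm{Id}$, followed by a measurement whose outcome is the guess for $i$. *)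

(* Defs.v *)
(* complex numbers R[i] over an abstract R : realType
   (mathcomp-real-closed), matrices, unitaries (spectral.v), tensor
   products of matrices (real_closed/mxtens.v), pi/asin (analysis trigo). *)
From HB Require Import structures.
From mathcomp Require Import all_boot all_order all_algebra.
From mathcomp Require Import reals trigo.
From mathcomp.real_closed Require Export complex mxtens.
Set Implicit Arguments.
Unset Strict Implicit.
Unset Printing Implicit Defensive.
Import Order.TTheory GRing.Theory Num.Theory.
Local Open Scope ring_scope.
Local Open Scope sesquilinear_scope.

Section QDefs.
Variable R : realType.
Local Notation C := R[i].

(* computational basis ket |j> as a column vector *)
Definition ket (n : nat) (j : 'I_n) : 'cV[C]_n := delta_mx j 0.

(* qubit basis states |0>, |1> *)
Definition q0 : 'I_2 := ord0.
Definition q1 : 'I_2 := ord_max.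

(* O is a unitary on H_A (x) C^2 (dimension N*2) with
   O|i>|0> = -|i>|1> and O|j>|0> = |j>|1> for j <> i. *)
Definition is_oracle (N : nat) (O : 'M[C]_(N * 2)) (i : 'I_N) : Prop :=
  O \is unitarymx /\
  forall j : 'I_N,
    O *m (ket j *t ket q0) = (if j == i then -1 else 1) *: (ket j *t ket q1).

(* the noisy oracle channel F(rho) = p O rho O^dagger + (1-p) rho *)
Definition noisy_chan (n : nat) (p : R) (O : 'M[C]_n) (rho : 'M[C]_n) : 'M[C]_n :=
  (p%:C)%C *: (O *m rho *m O ^t*) + ((1 - p)%:C)%C *: rho.

(* Phi (x) Id_W acting on matrices on C^n (x) C^W (index order of mxtens):
   (Phi (x) Id)(rho) = sum_{a,b} Phi(rho_{ab}) (x) |a><b|,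
   rho_{ab} being the (a,b) block of rho w.r.t. the second factor. *)
Definition tens_id (n W : nat) (Phi : 'M[C]_n -> 'M[C]_n) (rho : 'M[C]_(n * W))
  : 'M[C]_(n * W) :=
  \sum_(a < W) \sum_(b < W)
     Phi (\matrix_(x, y) rho (mxtens_index (x, a)) (mxtens_index (y, b)))
       *t (delta_mx a b : 'M[C]_W).

(* A query algorithm with k queries on H_A (x) C^2 (x) workspace C^W:
   start in a normalized pure state psi0, apply U_0, then k times
   (query; U_t), and finally measure in the computational basis and
   output guess(b). *)
Record algorithm (N k : nat) := Algorithm {
  W : nat;
  psi0 : 'cV[C]_(N * 2 * W);
  psi0_normalized : psi0 ^t* *m psi0 = 1;
  U : 'I_k.+1 -> 'M[C]_(N * 2 * W);
  U_unitary : forall t, U t \is unitarymx;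
  guess : 'I_(N * 2 * W) -> 'I_N
}.
Arguments W {N k}.
Arguments psi0 {N k}.
Arguments U {N k}.
Arguments guess {N k}.

Definition conj_by (n : nat) (V : 'M[C]_n) (rho : 'M[C]_n) := V *m rho *m V ^t*.

(* final state when the oracle is F_i = noisy_chan p (O i) *)
Definition final_state (N k : nat) (A : algorithm N k) (p : R)
  (O : 'M[C]_(N * 2)) : 'M[C]_(N * 2 * W A) :=
  foldl (fun rho (t : 'I_k.+1) =>
           conj_by (U A t) (@tens_id (N * 2) (W A) (noisy_chan p O) rho))
        (conj_by (U A ord0) (psi0 A *m psi0 A ^t*))
        (behead (enum 'I_k.+1)).

(* probability that the measurement outcome (guess) equals i *)
Definition success_prob (N k : nat) (A : algorithm N k) (p : R)
  (O : 'M[C]_(N * 2)) (i : 'I_N) : C :=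
  \sum_(b | guess A b == i) final_state A p O b b.

Definition theta (N : nat) : R := 2 * asin (1 / Num.sqrt (N%:R)).

End QDefs.

(* Main.v *)
(* Feeding the oracle a flag qubit in state |0> makes its action heralded: the
   flag ends in |1> exactly when O_i acted, which then was a phase flip at i.
   Applying Grover's diffusion only when the flag is |1>, then exchanging the flag
   for a fresh |0>, gives after r queries the Grover state with X ~ Bin(r, p)
   iterations, which yields i with probability
   f(r) = E[sin^2((X + 1/2) theta)].
   With the diffusion switched off, further queries only change phases in the
   computational basis, so an algorithm with k queries attains f(r) for each r <= k.
   Finally f(r) is (1/2p) times the increment in r of
   E[X - sin(2 X theta) / (2 sin theta)], so by telescoping
   f(0) + ... + f(k) >= ((k + 1) - 1 / (2 p sin theta)) / 2; for
   k + 1 > pi / (2 theta p), Jordan's inequality sin theta >= 2 theta / pi makes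
   this at least (k + 1) / 4, and some f(r) is at least 1/4. *)
Require Import Defs.
From HB Require Import structures.
From mathcomp Require Import all_boot all_order all_algebra.
From mathcomp Require Import reals trigo.
From mathcomp.real_closed Require Import complex mxtens.
From mathcomp Require Import fingroup perm ring lra.
From mathcomp Require Import classical_sets topology normedtype derive realfun.
Set Implicit Arguments.
Unset Strict Implicit.
Unset Printing Implicit Defensive.
Import Order.TTheory GRing.Theory Num.Theory numFieldNormedType.Exports.
Local Open Scope ring_scope.
Local Open Scope sesquilinear_scope.

(** * Jordan's inequality and averages over a binomial iteration count *)

Section Analysis.
Variable R : realType.
Implicit Types (x c : R) (f : nat -> R) (m r n : nat).

(** Concavity of sine: by the mean value theorem its slopes over [0, x] and [x, pi/2] are cosines at
    ordered points, so the first slope is the larger. *)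
Lemma jordan_sin x : 0 <= x <= pi / 2 -> 2 * x <= pi * sin x.
Proof.
move=> /andP[x0 xpi]; have pi0 : (0 : R) < pi := pi_gt0 R.
have ds (y : R) : is_derive y 1 sin (cos y) by exact: is_derive_sin.
have cs (a b : R) : {within `[a, b], continuous (@sin R)}%classic.
  by apply: continuous_subspaceT => y; exact: continuous_sin.
have [c1 + e1] := MVT_segment x0 (fun y _ => ds y) (cs 0 x).
have [c2 + e2] := MVT_segment xpi (fun y _ => ds y) (cs x (pi / 2)).
rewrite !in_itv /= => /andP[xc2 c2pi] /andP[c10 c1x].
have c21 : cos c2 <= cos c1.
  have [->//|ne] := eqVneq c1 c2.
  apply/ltW; rewrite ltr_cos ?in_itv /=; first by lra.
  - by apply/andP; split; lra.
  - by apply/andP; split; lra.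
rewrite sin0 !subr0 in e1; rewrite sin_pihalf in e2.
have : cos c2 * (pi / 2 - x) <= cos c1 * (pi / 2 - x) by rewrite ler_wpM2r // subr_ge0.
(* The terms [cos c1 * x] cancel, leaving 1 <= (pi/2) cos c1. *)
rewrite -e2 e1 => h; have {}h : 2 <= pi * cos c1 by lra.
by rewrite mulrA ler_wpM2r.
Qed.

(* The expectation of [f (m + X)] for [X] binomial with parameters [r], [p]. *)
Fixpoint binexp (p : R) f m r : R :=
  if r is r'.+1 then p * binexp p f m.+1 r' + (1 - p) * binexp p f m r'
  else f m.

(** An extra trial raises the count by one with probability [p]. Since [binexp] conditions on the
    first trial, the induction needs every offset [m]. *)
Lemma binexp_diff (p : R) f g a m r : (forall n, g n.+1 - g n = a * f n) ->
  binexp p g m r.+1 - binexp p g m r = a * p * binexp p f m r.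
Proof.
move=> fg; elim: r m => [|r IH] m /=; first by rewrite -mulrAC -fg; ring.
have := IH m; have := IH m.+1; rewrite /= => h1 h2.
suff : forall a1 a2 b1 b2 : R, a1 - a2 = a * p * binexp p f m.+1 r ->
  b1 - b2 = a * p * binexp p f m r ->
  p * a1 + (1 - p) * b1 - (p * a2 + (1 - p) * b2) =
  a * p * (p * binexp p f m.+1 r + (1 - p) * binexp p f m r) by exact.
move=> a1 a2 b1 b2 e1 e2.
transitivity (p * (a1 - a2) + (1 - p) * (b1 - b2)); first by ring.
by rewrite e1 e2; ring.
Qed.

Lemma binexp_ge (p : R) f c m r : 0 <= p <= 1 -> (forall n, n%:R - c <= f n) ->
  m%:R + p * r%:R - c <= binexp p f m r.
Proof.
move=> /andP[p0 p1] fge; elim: r m => [|r IH] m /=.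
  by rewrite mulr0 addr0.
have := IH m; have := IH m.+1; rewrite -[m.+1]addn1 -[r.+1]addn1 !natrD => h1 h2.
have := ler_wpM2l p0 h1; have q0 : 0 <= 1 - p by lra.
have := ler_wpM2l q0 h2; nra.
Qed.

Lemma sum_binexp_sin2 (p t : R) n : 0 < p <= 1 -> 0 < sin t ->
  n%:R - (2 * p * sin t)^-1 <=
  2 * \sum_(0 <= r < n) binexp p (fun m => sin ((m%:R + 2^-1) * t) ^+ 2) 0 r.
Proof.
move=> /andP[p0 p1] s0.
(* [g] is a discrete antiderivative of [2 sin^2 ((m + 1/2) t)]. *)
pose g m := m%:R - sin (2 * m%:R * t) / (2 * sin t).
set f := (X in binexp p X).
have gE m : g m.+1 - g m = 2 * f m.
  rewrite /g /f; set u := (m%:R + 2^-1) * t.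
  have -> : 2 * m.+1%:R * t = u *+ 2 + t by rewrite /u -addn1 natrD; field.
  have -> : 2 * m%:R * t = u *+ 2 - t by rewrite /u; field.
  (* The sines differ by 2 cos(2u) sin t, so the increment of [g] is 1 - cos(2u) = 2 sin^2 u. *)
  rewrite sinD sinB cos_mulr2n cos2sin2 -addn1 natrD.
  by field; rewrite gt_eqF.
have := telescope_sumr (binexp p g 0) (leq0n n).
rewrite (eq_bigr (fun r => 2 * p * binexp p f 0 r)); last first.
  by move=> r _; exact: binexp_diff.
rewrite -mulr_sumr => e.
(* As sin <= 1, [g m] is at least m - 1/(2 sin t); moreover [g 0] vanishes. *)
have := @binexp_ge p g (2 * sin t)^-1 0 n _ _.
rewrite ltW // p1 => /(_ isT) h.
have {}h : p * n%:R - (2 * sin t)^-1 <= 2 * p * \sum_(0 <= r < n) binexp p f 0 r.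
  rewrite e {2}/binexp /g mulr0 mul0r sin0 mul0r !subr0 -[X in X - _ <= _]add0r.
  apply: h => m; rewrite lerD2l lerN2 ler_pdivrMr ?mulr_gt0 //.
  by rewrite mulVf ?sin_le1 // gt_eqF ?mulr_gt0.
rewrite -(ler_pM2l p0) mulrBr mulrCA mulrA (mulrAC 2 p) invfM mulrCA.
by rewrite mulfV ?gt_eqF // mulr1.
Qed.

Lemma exists_binexp_sin2 (p t : R) : 0 < p <= 1 -> 0 < t <= pi / 2 ->
  exists2 r, (r <= Num.truncn (pi / (2 * t * p)))%N &
    4^-1 <= binexp p (fun m => sin ((m%:R + 2^-1) * t) ^+ 2) 0 r.
Proof.
move=> /andP[p0 p1] /andP[t0 tpi]; set k := Num.truncn _.
set f := (X in binexp p X).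
have s0 : 0 < sin t by rewrite sin_gt0_pi // t0; have := pi_gt0 R; lra.
have J : 2 * t <= pi * sin t by rewrite jordan_sin // ltW.
have kp : pi < k.+1%:R * (2 * t * p).
  by rewrite -ltr_pdivrMr ?truncnS_gt // !mulr_gt0.
have inv : (2 * p * sin t)^-1 <= k.+1%:R / 2.
  rewrite -[leLHS]mul1r ler_pdivrMr ?mulr_gt0 //.
  have := pi_gt0 R; have n0 : 0 < k.+1%:R :> R by rewrite ltr0n.
  move: kp n0; set n := k.+1%:R => kp n0 pi0.
  (* Chains pi < n (2 t p) with Jordan's 2 t <= pi sin t; cancelling pi gives 1 < n p sin t. *)
  have h : pi * 1 < pi * (n * p * sin t).
    have := ler_wpM2l (ltW (mulr_gt0 n0 p0)) J; nra.
  by move: h; rewrite ltr_pM2l //; lra.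
have S := sum_binexp_sin2 k.+1 (introT andP (conj p0 p1)) s0.
(* Averaging: k + 1 values below 1/4 would sum to less than (k + 1)/4, against [S] and [inv]. *)
have : ~~ [forall r : 'I_k.+1, binexp p f 0 r < 4^-1].
  apply/negP => /forallP small.
  have : \sum_(0 <= r < k.+1) binexp p f 0 r < \sum_(0 <= r < k.+1) 4^-1.
    by rewrite !big_mkord; apply: ltr_sum => //; apply/hasP; exists ord0;
      rewrite ?mem_index_enum.
  rewrite sumr_const_nat subn0 -mulr_natl; lra.
rewrite negb_forall => /existsP[r]; rewrite -leNgt; exists r => //.
by rewrite -ltnS.
Qed.

End Analysis.

(** * Tensor products, adjoints and unitarity *)

Section TensorAlgebra.
Variable C : numClosedFieldType.

Lemma adjmxM m n q (A : 'M[C]_(m, n)) (B : 'M[C]_(n, q)) :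
  (A *m B)^t* = B^t* *m A^t*.
Proof. by rewrite trmx_mul map_mxM. Qed.

Lemma adjmx_tens m n q s (A : 'M[C]_(m, n)) (B : 'M[C]_(q, s)) :
  (A *t B)^t* = A^t* *t B^t*.
Proof. by rewrite trmx_tens map_mxT. Qed.

Lemma tensmxDl m n q s (A A' : 'M[C]_(m, n)) (B : 'M[C]_(q, s)) :
  (A + A') *t B = A *t B + A' *t B.
Proof. by apply/matrixP => i j; rewrite !mxE mulrDl. Qed.

Lemma tensmxDr m n q s (A : 'M[C]_(m, n)) (B B' : 'M[C]_(q, s)) :
  A *t (B + B') = A *t B + A *t B'.
Proof. by apply/matrixP => i j; rewrite !mxE mulrDr. Qed.

Lemma tensmxZl m n q s c (A : 'M[C]_(m, n)) (B : 'M[C]_(q, s)) :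
  (c *: A) *t B = c *: (A *t B).
Proof. by apply/matrixP => i j; rewrite !mxE mulrA. Qed.

Lemma tensmx11 m n : 1%:M *t 1%:M = 1%:M :> 'M[C]_(m * n).
Proof.
apply/matrixP => i j; case: (mxtens_indexP i) => a b; case: (mxtens_indexP j) => c d.
rewrite tensmxE !mxE -natrM mulnb; congr (nat_of_bool _)%:R.
by rewrite (can_eq (@mxtens_indexK m n)) xpair_eqE.
Qed.

Lemma perm_mx_unitary n (s : 'S_n) : perm_mx s \is @unitarymx C n n.
Proof.
by apply/unitarymxP; rewrite tr_perm_mx map_perm_mx -perm_mxM mulgV perm_mx1.
Qed.

Lemma tensmx_unitary m n (A : 'M[C]_m) (B : 'M[C]_n) :
  A \is unitarymx -> B \is unitarymx -> A *t B \is unitarymx.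
Proof.
move=> /unitarymxP uA /unitarymxP uB; apply/unitarymxP.
by rewrite adjmx_tens tensmx_mul uA uB tensmx11.
Qed.

Lemma sum_blocks n w (rho : 'M[C]_(n * w)) :
  \sum_(a < w) \sum_(b < w)
     (\matrix_(x, y) rho (mxtens_index (x, a)) (mxtens_index (y, b)))
       *t (delta_mx a b : 'M[C]_w) = rho.
Proof.
apply/matrixP => i j; case: (mxtens_indexP i) => x a; case: (mxtens_indexP j) => y b.
rewrite summxE (bigD1 a) //= summxE (bigD1 b) //= tensmxE !mxE !eqxx mulr1.
rewrite big1 ?addr0 => [|b' /negPf nb].
  rewrite big1 ?addr0 // => a' /negPf na; rewrite summxE big1 // => b' _.
  by rewrite tensmxE !mxE eq_sym na mulr0.
by rewrite tensmxE !mxE (eq_sym b) nb andbF mulr0.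
Qed.

End TensorAlgebra.

(** * Queries as mixtures of pure states *)

Section Evolution.
Variable R : realType.
Local Notation C := R[i].

Lemma conj_byD n (V A B : 'M[C]_n) : conj_by V (A + B) = conj_by V A + conj_by V B.
Proof. by rewrite /conj_by mulmxDr mulmxDl. Qed.

Lemma conj_byZ n c (V A : 'M[C]_n) : conj_by V (c *: A) = c *: conj_by V A.
Proof. by rewrite /conj_by -scalemxAr -scalemxAl. Qed.

Lemma conj_by_pure n (V : 'M[C]_n) (v : 'cV[C]_n) :
  conj_by V (v *m v^t*) = (V *m v) *m (V *m v)^t*.
Proof. by rewrite /conj_by adjmxM !mulmxA. Qed.

(** Splitting rho into blocks tensored with |a><b| turns the blockwise channel into conjugation by
    [O *t 1%:M]. *)
Lemma tens_id_noisy n w (p : R) (O : 'M[C]_n) (rho : 'M[C]_(n * w)) :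
  tens_id (noisy_chan p O) rho =
    (p%:C)%C *: conj_by (O *t 1%:M) rho + ((1 - p)%:C)%C *: rho.
Proof.
rewrite -[X in conj_by _ X]sum_blocks -[X in _ + _ *: X]sum_blocks /tens_id.
rewrite /conj_by mulmx_sumr mulmx_suml !scaler_sumr -big_split; apply: eq_bigr => a _.
rewrite mulmx_sumr mulmx_suml !scaler_sumr -big_split; apply: eq_bigr => b _ /=.
by rewrite /noisy_chan tensmxDl !tensmxZl adjmx_tens !tensmx_mul
  trmx1 map_mx1 mul1mx mulmx1.
Qed.

(** The fold body of [final_state], for an arbitrary family of unitaries. *)
Definition query_step n w k (p : R) (O : 'M[C]_n) (V : 'I_k -> 'M[C]_(n * w))
    (rho : 'M[C]_(n * w)) (t : 'I_k) :=
  conj_by (V t) (tens_id (noisy_chan p O) rho).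

Lemma query_step_pure n w k (p : R) O V (v : 'cV[C]_(n * w)) (t : 'I_k) :
  query_step p O V (v *m v^t*) t =
  (p%:C)%C *: ((V t *m ((O *t 1%:M) *m v)) *m (V t *m ((O *t 1%:M) *m v))^t*) +
  ((1 - p)%:C)%C *: ((V t *m v) *m (V t *m v)^t*).
Proof.
by rewrite /query_step tens_id_noisy conj_byD !conj_byZ !conj_by_pure.
Qed.

(** Linearity of the evolution lets the two pure branches of each query be followed separately. *)
Lemma foldl_query_step n w k (p : R) O V (c d : C) (rho sigma : 'M[C]_(n * w))
    (ts : seq 'I_k) :
  foldl (query_step p O V) (c *: rho + d *: sigma) ts =
  c *: foldl (query_step p O V) rho ts + d *: foldl (query_step p O V) sigma ts.
Proof.
elim: ts rho sigma => //= t ts IH rho sigma; rewrite -IH; congr foldl.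
rewrite /query_step !tens_id_noisy !conj_byD !conj_byZ !conj_byD !conj_byZ.
have interchange (L : lmodType C) (a b : C) (x y x' y' : L) :
    a *: (c *: x + d *: y) + b *: (c *: x' + d *: y') =
    c *: (a *: x + b *: x') + d *: (a *: y + b *: y').
  by rewrite !scalerDr !scalerA !(mulrC a) !(mulrC b) addrACA.
exact: interchange.
Qed.

End Evolution.

Section Registers.
Variables (R : realType) (N K : nat).
Local Notation C := R[i].
Local Notation flag := 'I_2.
Local Notation history := {ffun 'I_K -> flag}.
Local Notation hdim := #|{: history}|.
Local Notation dim := (N * 2 * hdim)%N.
Implicit Types (x : 'cV[C]_N) (f : flag) (h : history) (t : 'I_K).

Definition register (y : 'I_N) (fh : flag * history) : 'I_dim :=
  mxtens_index (mxtens_index (y, fh.1), enum_rank fh.2).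

Definition query_index (b : 'I_dim) : 'I_N :=
  (mxtens_unindex (mxtens_unindex b).1).1.

Definition ancilla (b : 'I_dim) : flag * history :=
  ((mxtens_unindex (mxtens_unindex b).1).2, enum_val (mxtens_unindex b).2).

Lemma query_index_register y fh : query_index (register y fh) = y.
Proof. by rewrite /query_index /register !mxtens_indexK. Qed.

Lemma ancilla_register y fh : ancilla (register y fh) = fh.
Proof. by case: fh => f h; rewrite /ancilla /register !mxtens_indexK /= enum_rankK. Qed.

Lemma register_query_ancilla b : register (query_index b) (ancilla b) = b.
Proof.
case: (mxtens_indexP b) => c w; case: (mxtens_indexP c) => y f.
by rewrite /register /ancilla /query_index !mxtens_indexK /= enum_valK.
Qed.

(** The entrywise form suits permutations and measurement; [state_tens] gives the product form used
    for the oracle and the diffusion. *)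
Definition state x (fh : flag * history) : 'cV[C]_dim :=
  \col_b (x (query_index b) 0 * (ancilla b == fh)%:R).

Lemma state_tens x f h :
  state x (f, h) = x *t ket R f *t ket R (enum_rank h) :> 'cV[C]_dim.
Proof.
apply/matrixP => b j; rewrite -(register_query_ancilla b).
rewrite mxE query_index_register ancilla_register.
case: (ancilla b) => f' h'.
(* The only column index must itself be a pairing before [tensmxE] applies. *)
pose j3 : 'I_(1 * 1 * 1) := mxtens_index (mxtens_index (ord0, ord0), ord0).
have -> : j = j3 :> 'I_1 by rewrite [LHS]ord1; apply: val_inj.
rewrite /register; apply: esym.
rewrite [LHS]tensmxE tensmxE !mxE !eqxx !andbT -mulrA -natrM mulnb.
by rewrite (inj_eq enum_rank_inj) xpair_eqE.
Qed.

Lemma tens_mul_state (A : 'M[C]_(N * 2)) (B : 'M[C]_hdim) x f h :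
  (A *t B) *m state x (f, h) =
  (A *m (x *t ket R f)) *t (B *m ket R (enum_rank h)).
Proof. by rewrite state_tens; exact: (tensmx_mul A B (x *t ket R f) (ket R (enum_rank h))). Qed.

(** A reversible reset of the flag, provided cell [t] still holds a fresh |0>. *)
Definition swap_flag t (fh : flag * history) : flag * history :=
  (fh.2 t, [ffun s => if s == t then fh.1 else fh.2 s]).

Lemma swap_flagK t : involutive (swap_flag t).
Proof.
case=> f h; rewrite /swap_flag /=; congr (_, _); first by rewrite ffunE eqxx.
by apply/ffunP => s; rewrite !ffunE; case: eqP => [->|].
Qed.

Definition swap_register t (b : 'I_dim) := register (query_index b) (swap_flag t (ancilla b)).

Lemma swap_registerK t : involutive (swap_register t).
Proof.
move=> b; rewrite /swap_register query_index_register ancilla_register swap_flagK.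
exact: register_query_ancilla.
Qed.

Definition swap_mx t : 'M[C]_dim := perm_mx (perm (can_inj (swap_registerK t))).

Lemma swap_mx_state t x fh : swap_mx t *m state x fh = state x (swap_flag t fh).
Proof.
rewrite /swap_mx -row_permE; apply/matrixP => b j; rewrite !mxE permE.
rewrite query_index_register ancilla_register.
by rewrite (can2_eq (swap_flagK t) (swap_flagK t)).
Qed.

Definition flag_controlled (D : 'M[C]_N) : 'M[C]_dim :=
  (1%:M *t delta_mx q0 q0 + D *t delta_mx q1 q1) *t 1%:M.

Lemma flag_controlled_unitary D : D \is unitarymx -> flag_controlled D \is unitarymx.
Proof.
move=> /unitarymxP uD; apply: tensmx_unitary; last first.
  by apply/unitarymxP; rewrite trmx1 map_mx1 mulmx1.
apply/unitarymxP; rewrite linearD map_mxD !adjmx_tens !trmx_delta !map_delta_mx.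
(* The cross terms vanish because the two flag projectors are orthogonal; the projectors add up to
   the identity. *)
rewrite trmx1 map_mx1 mulmxDl !mulmxDr !tensmx_mul !mul_delta_mx_cond /=.
rewrite !mulr0n !tensmx0 addr0 add0r mulmx1 uD !mulr1n -tensmxDr -[RHS]tensmx11.
congr (_ *t _); apply/matrixP => i j; rewrite !mxE -natrD; congr (_%:R).
by case: i => [[|[|]] ?]; case: j => [[|[|]] ?].
Qed.

Lemma flag_controlled_state0 D x h : flag_controlled D *m state x (q0, h) = state x (q0, h).
Proof.
rewrite /flag_controlled tens_mul_state state_tens mulmxDl !tensmx_mul !mul1mx.
by rewrite !mul_delta_mx_cond /= mulr1n mulr0n tensmx0 addr0.
Qed.

Lemma flag_controlled_state1 D x h :
  flag_controlled D *m state x (q1, h) = state (D *m x) (q1, h).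
Proof.
rewrite /flag_controlled tens_mul_state state_tens mulmxDl !tensmx_mul !mul1mx.
by rewrite !mul_delta_mx_cond /= mulr1n mulr0n tensmx0 add0r.
Qed.

Definition phase_flip (i : 'I_N) x : 'cV[C]_N :=
  \col_j ((if j == i then -1 else 1) * x j 0).

(** [is_oracle] fixes the action on each |j>|0>, and linearity extends it to any [x]; the flag must
    therefore be |0> at each query. *)
Lemma oracle_state (O : 'M[C]_(N * 2)) i x h : is_oracle O i ->
  (O *t 1%:M) *m state x (q0, h) = state (phase_flip i x) (q1, h).
Proof.
move=> [_ HO]; rewrite tens_mul_state state_tens mul1mx.
suff -> : O *m (x *t ket R q0) = phase_flip i x *t ket R q1 by [].
have decomp (y : 'cV[C]_N) f : y *t ket R f = \sum_j y j 0 *: (ket R j *t ket R f).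
  apply/matrixP => b c; rewrite summxE.
  case: (mxtens_indexP b) => a g; case: (mxtens_indexP c) => c1 c2.
  rewrite [LHS]tensmxE (bigD1 a) //= big1 => [|j ja].
    by rewrite addr0 [RHS]mxE tensmxE !mxE !ord1 !eqxx mul1r.
  by rewrite mxE tensmxE !mxE eq_sym (negPf ja) mul0r mulr0.
rewrite !decomp mulmx_sumr; apply: eq_bigr => j _.
by rewrite -scalemxAr HO scalerA mxE mulrC.
Qed.

Definition success i (rho : 'M[C]_dim) : C := \sum_(b | query_index b == i) rho b b.

Lemma success_state i x fh :
  success i (state x fh *m (state x fh)^t*) = x i 0 * (x i 0)^*.
Proof.
rewrite /success (bigD1 (register i fh)) /= ?query_index_register //.
rewrite big1 => [|b /andP[/eqP bi nb]].
  rewrite mxE big_ord1 !mxE query_index_register ancilla_register eqxx.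
  by rewrite mulr1 addr0.
rewrite mxE big_ord1 !mxE; case: eqP => [e|_]; last by rewrite mulr0 mul0r.
by move: nb; rewrite -{1}[b]register_query_ancilla bi e eqxx.
Qed.

Lemma success_lin i (c d : C) rho sigma :
  success i (c *: rho + d *: sigma) = c * success i rho + d * success i sigma.
Proof.
rewrite /success !mulr_sumr -big_split; apply: eq_bigr => b _.
by rewrite !mxE.
Qed.

Lemma state_normalized x f h :
  x^t* *m x = 1 -> (state x (f, h))^t* *m state x (f, h) = 1.
Proof.
move=> x1; rewrite state_tens.
have ket1 n (j : 'I_n) : (ket R j)^t* *m ket R j = 1%:M.
  by rewrite /ket trmx_delta map_delta_mx mul_delta_mx; apply/matrixP => a b;
    rewrite !mxE !ord1.
pose v := x *t ket R f *t ket R (enum_rank h).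
suff : v^t* *m v = 1%:M by [].
by rewrite /v !adjmx_tens !tensmx_mul x1 !ket1 !tensmx11.
Qed.

End Registers.

(** * Grover iteration as a rotation by theta *)

Section Grover.
Variables (R : realType) (N : nat).
Hypothesis N_ge2 : (2 <= N)%N.
Local Notation C := R[i].
Local Notation th := (theta R N).

Let n2 : 2 <= N%:R :> R.
Proof. by rewrite ler_nat. Qed.

Let n0 : 0 < N%:R :> R.
Proof. by rewrite ltr0n; case: N N_ge2. Qed.

Let n1 : 0 < N%:R - 1 :> R.
Proof. by have := n2; lra. Qed.

Lemma half_thetaE : 2^-1 * th = asin (Num.sqrt (N%:R : R))^-1.
Proof. by rewrite /theta div1r mulrA mulVf ?mul1r ?pnatr_eq0. Qed.

Lemma sqrtV_bounds : -1 <= (Num.sqrt (N%:R : R))^-1 <= 1.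
Proof.
have s1 : 1 <= Num.sqrt (N%:R : R).
  by rewrite -[leLHS]sqrtr1 ler_wsqrtr //; have := n2; lra.
have sp : 0 < Num.sqrt (N%:R : R) by lra.
have v0 : 0 < (Num.sqrt (N%:R : R))^-1 by rewrite invr_gt0.
by rewrite invf_le1 // s1 andbT; lra.
Qed.

Lemma sin_half_theta : sin (2^-1 * th) = (Num.sqrt (N%:R : R))^-1.
Proof. by rewrite half_thetaE asinK // in_itv /= sqrtV_bounds. Qed.

Lemma cos_half_theta :
  cos (2^-1 * th) = Num.sqrt (N%:R - 1) * (Num.sqrt (N%:R : R))^-1.
Proof.
rewrite half_thetaE cos_asin ?sqrtV_bounds // -sqrtrV ?ler0n //.
rewrite -sqrtrM ?(ltW n1) // sqr_sqrtr ?invr_ge0 ?ler0n //.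
by rewrite mulrBl mul1r mulfV ?gt_eqF.
Qed.

Let sqN : (Num.sqrt (N%:R : R))^-1 ^+ 2 = N%:R^-1.
Proof. by rewrite exprVn sqr_sqrtr ?ler0n. Qed.

Lemma cos_theta : cos th = 1 - 2 / N%:R.
Proof.
have -> : th = (2^-1 * th) *+ 2 by field.
by rewrite cos_mulr2n cos2sin2 sin_half_theta sqN; field; rewrite gt_eqF.
Qed.

Lemma sin_theta : sin th = 2 * Num.sqrt (N%:R - 1) / N%:R.
Proof.
have -> : th = (2^-1 * th) *+ 2 by field.
by rewrite sin_mulr2n sin_half_theta cos_half_theta -sqN; ring.
Qed.

(** Positivity comes from sin(theta/2) = N^(-1/2) > 0; an angle above pi/2 would make cos theta = 1
    - 2/N negative, impossible for N >= 2. *)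
Lemma theta_bounds : 0 < th <= pi / 2.
Proof.
have pi0 := pi_gt0 R; have hb := sqrtV_bounds.
have := asin_lepi2 hb; have := asin_geNpi2 hb; rewrite -half_thetaE.
move=> lo hi.
have t0 : 0 < th.
  have -> : th = 2 * (2^-1 * th) by field.
  rewrite mulr_gt0 // -ltr_sin ?in_itv /= ?lo ?hi //; last first.
    by apply/andP; split; lra.
  by rewrite sin0 sin_half_theta invr_gt0 sqrtr_gt0.
rewrite t0 /= leNgt; apply/negP => big.
have : cos th < cos (pi / 2).
  by rewrite ltr_cos ?in_itv //=; apply/andP; split; lra.
rewrite cos_pihalf cos_theta subr_lt0 ltr_pdivlMr //; have := n2; lra.
Qed.

(** Inversion about the mean, 2|u><u| - 1 for the uniform superposition u: the all-ones matrix is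
    N|u><u|. *)
Definition diffusion : 'M[C]_N := (2 / N%:R) *: const_mx 1 - 1%:M.

Lemma diffusionE (x : 'cV[C]_N) j :
  (diffusion *m x) j 0 = 2 / N%:R * (\sum_l x l 0) - x j 0.
Proof.
rewrite mulmxBl mul1mx -scalemxAl !mxE; congr (_ * _ - _).
by apply: eq_bigr => l _; rewrite mxE mul1r.
Qed.

Lemma diffusion_unitary : diffusion \is unitarymx.
Proof.
have NC : N%:R != 0 :> C by rewrite pnatr_eq0; case: N N_ge2.
have adj : diffusion^t* = diffusion.
  rewrite /diffusion linearB linearZ /= trmx_const trmx1 map_mxB map_mxZ map_mx1.
  rewrite map_const_mx; congr (_ *: _ - _); last by rewrite rmorph1.
  by rewrite rmorphM fmorphV !rmorph_nat.
apply/unitarymxP; rewrite adj; apply/matrixP => j l.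
transitivity ((diffusion *m col l diffusion) j 0).
  by rewrite !mxE; apply: eq_bigr => k _; rewrite !mxE.
rewrite diffusionE (eq_bigr (fun k => 2 / N%:R - (k == l)%:R)); last first.
  by move=> k _; rewrite !mxE mulr1.
(* Each column sums to N (2/N) - 1 = 1, so the diffusion maps column l to |l>. *)
rewrite sumrB sumr_const card_ord (bigD1 l) //= big1 ?eqxx => [|k /negPf-> //].
by rewrite !mxE -[_ *+ N]mulr_natr /=; field.
Qed.

(** The unit vector at angle (m + 1/2) theta from the uniform superposition of the unmarked indices
    towards |i>. *)
Definition grover_state (i : 'I_N) (m : nat) : 'cV[C]_N :=
  \col_j (if j == i then sin ((m%:R + 2^-1) * th)
          else cos ((m%:R + 2^-1) * th) / Num.sqrt (N%:R - 1))%:C%C.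

Lemma grover_state0 i : grover_state i 0 = const_mx ((Num.sqrt (N%:R : R))^-1)%:C%C.
Proof.
apply/matrixP => j k; rewrite !mxE add0r sin_half_theta cos_half_theta.
case: ifP => // _; congr (_%:C)%C; rewrite mulrAC mulfV ?mul1r //.
by rewrite gt_eqF ?sqrtr_gt0.
Qed.

Lemma grover_iteration i m :
  diffusion *m phase_flip i (grover_state i m) = grover_state i m.+1.
Proof.
apply/matrixP => j k; rewrite [k]ord1 {k} diffusionE.
set u := (m%:R + 2^-1) * th.
have s0 : Num.sqrt (N%:R - 1 : R) != 0 by rewrite gt_eqF ?sqrtr_gt0.
have sS : Num.sqrt (N%:R - 1 : R) ^+ 2 = N%:R - 1 by rewrite sqr_sqrtr ?(ltW n1).
have -> : \sum_l phase_flip i (grover_state i m) l 0 =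
    ((N%:R - 1) * (cos u / Num.sqrt (N%:R - 1)) - sin u)%:C%C.
  rewrite (bigD1 i) //= !mxE eqxx.
  rewrite (eq_bigr (fun=> (cos u / Num.sqrt (N%:R - 1))%:C%C)); last first.
    by move=> l /negPf li; rewrite !mxE li mul1r.
  rewrite sumr_const cardC1 card_ord addrC mulN1r rmorphB /=.
  rewrite [X in _ = X - _]rmorphM -[X in X - _ = _]mulr_natl; congr (_ * _ - _).
  by rewrite -[in RHS](ltn_predK N_ge2) -addn1 natrD addrK rmorph_nat.
have -> : 2 / N%:R = (2 / N%:R : R)%:C%C by rewrite rmorphM fmorphV !rmorph_nat.
have uS : (m.+1%:R + 2^-1) * th = u + th by rewrite /u -addn1 natrD; ring.
rewrite !mxE uS sinD cosD cos_theta sin_theta -!rmorphM.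
(* With s = sqrt(N - 1) and N = s^2 + 1, the addition formulas become rational identities in s. *)
rewrite -/u; move: (Num.sqrt _) s0 sS => s s0 sS.
have eN : N%:R = s ^+ 2 + 1 by rewrite sS subrK.
have := n0; rewrite eN => /lt0r_neq0 N0.
case: ifP => _.
  by rewrite mulN1r -rmorphN -rmorphB; congr (_%:C)%C; field; rewrite s0 N0.
by rewrite mul1r -rmorphB; congr (_%:C)%C; field; rewrite s0 N0.
Qed.

End Grover.

(** * The heralded algorithm and its success probability *)

Section HeraldedGrover.
Variables (R : realType) (N k : nat) (p : R).
Hypothesis N_ge2 : (2 <= N)%N.
Local Notation C := R[i].
Local Notation history := {ffun 'I_k.+1 -> 'I_2}.
Local Notation pure v := (v *m v^t*).
Implicit Types (ts : seq 'I_k.+1) (h : history) (i : 'I_N).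

(* Position [t] of the history is the fresh |0> consumed by query [t]; position 0
   makes the initial unitary a swap of two |0>s, which fixes the start state. *)
Definition heralded_unitary (r : nat) (t : 'I_k.+1) : 'M[C]_(N * 2 * #|{: history}|) :=
  if (0 < t <= r)%N then swap_mx R N t *m flag_controlled k.+1 (diffusion R N)
  else swap_mx R N t.

Lemma heralded_unitaryP r t : heralded_unitary r t \is unitarymx.
Proof.
rewrite /heralded_unitary; case: ifP => _; last exact: perm_mx_unitary.
by rewrite mul_unitarymx ?perm_mx_unitary ?flag_controlled_unitary ?diffusion_unitary.
Qed.

(** The invariant of the run: the flag returns to |0>, and by [uniq] the cells of later queries stay
    untouched. *)
Lemma swap_flag_fresh t ts f h : uniq (t :: ts) ->
  {in t :: ts, forall s, h s = q0} ->
  exists2 h', swap_flag t (f, h) = (q0, h') & {in ts, forall s, h' s = q0}.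
Proof.
move=> /andP[tts _] h0; exists (swap_flag t (f, h)).2 => [|s sts].
  by rewrite /swap_flag /= h0 // mem_head.
rewrite ffunE; case: eqP => [e|_]; first by rewrite e in sts; rewrite sts in tts.
by rewrite /= h0 // in_cons sts orbT.
Qed.

Lemma success_query (O : 'M[C]_(N * 2)) i r x h t ts : is_oracle O i ->
  success i (foldl (query_step p O (heralded_unitary r)) (pure (state x (q0, h))) (t :: ts)) =
  (p%:C)%C * success i (foldl (query_step p O (heralded_unitary r))
    (pure (heralded_unitary r t *m state (phase_flip i x) (q1, h))) ts) +
  ((1 - p)%:C)%C * success i (foldl (query_step p O (heralded_unitary r))
    (pure (heralded_unitary r t *m state x (q0, h))) ts).
Proof.
move=> HO; rewrite [foldl _ _ (_ :: _)]/= query_step_pure foldl_query_step success_lin.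
by rewrite (oracle_state _ _ HO).
Qed.

Lemma success_idle (O : 'M[C]_(N * 2)) i r x h ts : is_oracle O i ->
  uniq ts -> {in ts, forall t, h t = q0} -> {in ts, forall t : 'I_k.+1, (r < t)%N} ->
  success i (foldl (query_step p O (heralded_unitary r)) (pure (state x (q0, h))) ts)
  = x i 0 * (x i 0)^*.
Proof.
move=> HO; elim: ts x h => [|t ts IH] x h uts h0 idle; first exact: success_state.
have Ut : heralded_unitary r t = swap_mx R N t.
  by rewrite /heralded_unitary [(t <= r)%N]leqNgt idle ?mem_head ?andbF.
have idle' : {in ts, forall t : 'I_k.+1, (r < t)%N}.
  by move=> s sts; rewrite idle // in_cons sts orbT.
have uts' : uniq ts by case/andP: uts.
rewrite success_query // Ut !swap_mx_state.
have [h1 -> h10] := swap_flag_fresh q1 uts h0.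
have [h2 -> h20] := swap_flag_fresh q0 uts h0.
(* The sign acquired at [i] disappears in the squared modulus, and the branch weights add up to
   1. *)
rewrite !IH // mxE eqxx mulN1r rmorphN mulrNN -mulrDl -rmorphD.
by rewrite addrC subrK rmorph1 mul1r.
Qed.

(** The induction on [ts1] mirrors the recursion of [binexp]: the branch where the oracle acted
    advances [m], the other keeps it. The idle queries [ts2] preserve the result. *)
Lemma success_grover (O : 'M[C]_(N * 2)) i r m h ts1 ts2 : is_oracle O i ->
  uniq (ts1 ++ ts2) -> {in ts1 ++ ts2, forall t, h t = q0} ->
  {in ts1, forall t : 'I_k.+1, (0 < t <= r)%N} ->
  {in ts2, forall t : 'I_k.+1, (r < t)%N} ->
  success i (foldl (query_step p O (heralded_unitary r))
    (pure (state (grover_state R i m) (q0, h))) (ts1 ++ ts2)) =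
  (binexp p (fun n => sin ((n%:R + 2^-1) * theta R N) ^+ 2) m (size ts1))%:C%C.
Proof.
move=> HO; elim: ts1 m h => [|t ts1 IH] m h uts h0 active idle.
  rewrite success_idle // mxE eqxx conj_Creal -?rmorphM ?expr2 //.
  by rewrite complex_real.
have Ut (v : 'cV_(N * 2 * #|{: history}|)) : heralded_unitary r t *m v =
    swap_mx R N t *m (flag_controlled k.+1 (diffusion R N) *m v).
  by rewrite /heralded_unitary active ?mem_head // mulmxA.
have active' : {in ts1, forall t : 'I_k.+1, (0 < t <= r)%N}.
  by move=> s sts; rewrite active // in_cons sts orbT.
have uts' : uniq (ts1 ++ ts2) by case/andP: uts.
rewrite cat_cons success_query // !Ut flag_controlled_state0.
rewrite flag_controlled_state1 grover_iteration // !swap_mx_state.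
have [h1 -> h10] := swap_flag_fresh q1 uts h0.
have [h2 -> h20] := swap_flag_fresh q0 uts h0.
by rewrite !IH // -!rmorphM -rmorphD.
Qed.

Definition uniform_state : 'cV[C]_N := const_mx ((Num.sqrt (N%:R : R))^-1)%:C%C.

Lemma uniform_state_normalized : uniform_state^t* *m uniform_state = 1.
Proof.
apply/matrixP => a b; rewrite !mxE !ord1 eqxx.
rewrite (eq_bigr (fun=> (N%:R^-1)%:C%C)) => [|l _]; last first.
  rewrite !mxE conj_Creal ?complex_real // -rmorphM -expr2 exprVn.
  by rewrite sqr_sqrtr ?ler0n.
rewrite sumr_const card_ord fmorphV rmorph_nat -[LHS]mulr_natl mulfV //.
by rewrite pnatr_eq0; case: N N_ge2.
Qed.

Definition empty_history : history := [ffun=> q0].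

Definition heralded_grover (r : nat) : algorithm R N k :=
  Algorithm (state_normalized q0 empty_history uniform_state_normalized)
    (heralded_unitaryP r) (@query_index N k.+1).

Lemma success_heralded_grover (O : 'M[C]_(N * 2)) i r : is_oracle O i -> (r <= k)%N ->
  success_prob (heralded_grover r) p O i =
  (binexp p (fun n => sin ((n%:R + 2^-1) * theta R N) ^+ 2) 0 r)%:C%C.
Proof.
move=> HO rk; rewrite /success_prob /final_state /= conj_by_pure.
have -> : heralded_unitary r ord0 *m state uniform_state (q0, empty_history) =
    state (grover_state R i 0) (q0, empty_history).
  rewrite /heralded_unitary /= swap_mx_state grover_state0 //; congr state.
  rewrite /swap_flag /= ffunE; congr pair.
  by apply/ffunP => s; rewrite !ffunE; case: ifP.
(* Dropping [ord0] leaves the times 1 to k: the first [r] are active, the rest idle. *)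
set ts := behead _; have vts : map val ts = iota 1 k.
  by rewrite /ts -behead_map val_enum_ord.
have szts : size ts = k by rewrite -(size_map val) vts size_iota.
have sz1 : size (take r ts) = r by rewrite size_takel ?szts.
rewrite -[ts](cat_take_drop r) -[in RHS]sz1.
apply: (success_grover (r := r)) => //.
- by rewrite cat_take_drop -(map_inj_uniq val_inj) vts iota_uniq.
- by move=> t _; rewrite ffunE.
- move=> t /(map_f val); rewrite map_take vts take_iota mem_iota.
  by rewrite (minn_idPl rk) add1n ltnS.
- move=> t /(map_f val); rewrite map_drop vts drop_iota mem_iota add1n.
  by case/andP.
Qed.

End HeraldedGrover.

Theorem theorem8 (R : realType) (N : nat) (p : R)
    (O : 'I_N -> 'M[R[i]]_(N * 2)) :
  (2 <= N)%N -> 0 < p <= 1 ->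
  (forall i : 'I_N, is_oracle (O i) i) ->
  exists A : algorithm R N (Num.truncn (pi / (2 * theta R N * p))),
    forall i : 'I_N, ((4^-1 : R)%:C)%C <= success_prob A p (O i) i.
Proof.
move=> N2 p01 HO.
have [r rk rP] := exists_binexp_sin2 p01 (theta_bounds R N2).
(* [r] is chosen from [N] and [p] alone, so one algorithm serves every [i]. *)
exists (heralded_grover R _ N2 r) => i.
by rewrite success_heralded_grover // lecR.
Qed.
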